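(* Let $X,Y$ be pointed metric spaces, $0<q\le s\le\infty$ and $0<p\le q$. A Lipschitz map $S:X\to Y$ is Lipschitz $(\mathfrak{m}^L(s;q),p)$-summing if and only if there is a constant $C\ge0$ such that $$\Bigg[\sum_{j=1}^{m}|\sigma_j|^{q}\bigg[\sum_{k=1}^{n}|g_k(Sx'_j)-g_k(Sx''_j)|^{s}\bigg]^{\frac qs}\Bigg]^{\frac1q}\le C\cdot\big\|(\sigma,x',x'')\big|\ell_p^{L,w}\big\|\cdot\big\|(g_k)_{k=1}^{n}\big|\ell_s(Y^{\#})\big\|$$ for every $\sigma_1,\dots,\sigma_m\in\mathbb{R}$; $x'_1,\dots,x'_m,x''_1,\dots,x''_m\in X$; $g_1,\dots,g_n\in Y^{\#}$ and $m,n\in\mathbb{N}$. Moreover $\pi^L_{(\mathfrak{m}^L(s;q),p)}(S)=\inf C$, the infimum over all such constants $C$.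
   Context: For a metric space $X$ with base point $x_0$, $X^{\#}$ is the Banach space of real-valued Lipschitz functions on $X$ vanishing at $x_0$, with norm $Lip(\cdot)$ (the Lipschitz constant); $B_{X^{\#}}$ is its closed unit ball. $(\sigma,x',x'')$ denotes a finite sequence $(\sigma_j,x'_j,x''_j)_{j=1}^m$ in $\mathbb{R}\times X\times X$. Indices lie in $(0,\infty]$, $1/\infty=0$. Put $\|(\sigma,x',x'')|\ell_p^{L,w}\|=\sup_{f\in B_{X^{\#}}}\big[\sum_j|\sigma_j|^p|f(x'_j)-f(x''_j)|^p\big]^{1/p}$ and $\|(g_k)_{k=1}^n|\ell_s(Y^{\#})\|=\big[\sum_k Lip(g_k)^s\big]^{1/s}$; whenever an exponent is $\infty$, the corresponding $\ell$-sum is replaced by a supremum. For $0<q\le s\le\infty$ let $s'(q)\in(0,\infty]$ be given by $\frac1{s'(q)}+\frac1s=\frac1q$, and put $\mathfrak{m}^L_{(s;q)}(\sigma,x',x'')=\inf_\tau\|\tau|\ell_{s'(q)}\|\,\|(\sigma/\tau,x',x'')|\ell_s^{L,w}\|$, the infimum over all $\tau=(\tau_j)$ with $\tau_j\in\mathbb{R}\setminus\{0\}$, where $\sigma/\tau=(\sigma_j/\tau_j)_j$. For $0<q\le s\le\infty$ and $p\le q$, a Lipschitz map $T:X\to Y$ is Lipschitz $(\mathfrak{m}^L(s;q),p)$-summing if there is $C\ge0$ with $\mathfrak{m}^L_{(s;q)}(\sigma,Tx',Tx'')\le C\,\|(\sigma,x',x'')|\ell_p^{L,w}\|$ for all finite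 sequences $(\sigma,x',x'')$ in $\mathbb{R}\times X\times X$; $\pi^L_{(\mathfrak{m}^L(s;q),p)}(T)$ is the infimum of such $C$. *)

(* Defs.v *)
From HB Require Import structures.
From mathcomp Require Import all_boot all_order all_algebra.
From mathcomp Require Import all_classical all_reals all_analysis.

Set Implicit Arguments.
Unset Strict Implicit.
Unset Printing Implicit Defensive.
Import Order.TTheory GRing.Theory Num.Theory.

Local Open Scope classical_set_scope.
Local Open Scope ring_scope.

(* Indices in (0, oo] are elements of \bar R, the hypotheses 0 < p being stated
   where they are used; the branch of lp_norm below taken by +oo is also taken
   by the meaningless value -oo. *)

Section finite_lp.
Context {R : realType}.

(* The maximum starts from 0, so the norm of the empty sequence is 0 for every
   index. *)
Definition lp_norm (p : \bar R) (n : nat) (a : 'I_n -> R) : R :=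
  if p is r%:E then (\sum_(i < n) `|a i| `^ r) `^ r^-1
  else \big[Order.max/0]_(i < n) `|a i|.

(* s'(q), that is 1/s'(q) + 1/s = 1/q, see mixed_indexP; in \bar R the inverse
   satisfies 0^-1 = +oo and +oo^-1 = 0. *)
Definition mixed_index (s q : \bar R) : \bar R := ((q^-1 - s^-1)^-1)%E.

Lemma mixed_indexP (s q : \bar R) : (0 < q)%E -> (q <= s)%E ->
  (0 < mixed_index s q)%E /\ ((mixed_index s q)^-1 + s^-1 = q^-1)%E.
Proof.
move=> q0 qs; have s0 : (0 < s)%E by exact: lt_le_trans qs.
have fin_inv (t : \bar R) : (0 < t)%E -> (t^-1)%E \is a fin_num.
  case: t => [t| |] //=.
  by rewrite lte_fin => t0; rewrite inver gt_eqF.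
rewrite /mixed_index inveK subeK ?fin_inv//; split=> //.
rewrite lt0e inve_ge0 inve_eq0; apply/andP; split.
  have : ((q^-1 - s^-1)%E \is a fin_num) by rewrite fin_numB !fin_inv.
  by rewrite fin_numE => /andP[_].
rewrite sube_ge0 ?fin_inv//.
case: s q s0 q0 qs {fin_inv} => [s| |] [q| |] //=.
  rewrite !lte_fin !lee_fin => s0 q0 qs.
  by rewrite !inver !gt_eqF// lee_fin lef_pV2.
by move=> _ q0 _; rewrite invey inve_ge0 ltW.
Qed.

End finite_lp.

Section lipschitz_dual.
Context {R : realType}.

Definition lipschitz_map (X Y : metricType R) (T : X -> Y) : Prop :=
  exists K : R, forall x y, mdist (T x) (T y) <= K * mdist x y.

Context {X : metricType R}.

Definition lip_constants (f : X -> R) : set R :=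
  [set K | 0 <= K /\ forall x y, `|f x - f y| <= K * mdist x y].

(* Lip(f); only meaningful when lip_constants f is nonempty. *)
Definition Lip (f : X -> R) : R := inf (lip_constants f).

(* X^#, as a set of functions; its norm is Lip. *)
Definition lip_dual (x0 : X) : set (X -> R) :=
  [set f | f x0 = 0 /\ lip_constants f !=set0].

Definition lip_dual_ball (x0 : X) : set (X -> R) :=
  [set f | lip_dual x0 f /\ Lip f <= 1].

End lipschitz_dual.

Section mixed_summing.
Context {R : realType}.

(* || (sigma, x', x'') | l_p^{L,w} || *)
Definition weak_lip_norm (X : metricType R) (x0 : X) (p : \bar R) (m : nat)
    (sigma : 'I_m -> R) (x' x'' : 'I_m -> X) : \bar R :=
  ereal_sup [set (lp_norm p (fun j => sigma j * (f (x' j) - f (x'' j))))%:E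
            | f in lip_dual_ball x0].

(* m^L_{(s;q)}(sigma, x', x'') *)
Definition mixed_lip_norm (X : metricType R) (x0 : X) (s q : \bar R) (m : nat)
    (sigma : 'I_m -> R) (x' x'' : 'I_m -> X) : \bar R :=
  ereal_inf [set ((lp_norm (mixed_index s q) tau)%:E *
                  weak_lip_norm x0 s (fun j => sigma j / tau j)%R x' x'')%E
            | tau in [set tau : 'I_m -> R | forall j, tau j != 0]].

Context {X Y : metricType R} (x0 : X) (y0 : Y).

Definition mixed_summing_constants (s q p : \bar R) (T : X -> Y) : set R :=
  [set C | 0 <= C /\
    forall (m : nat) (sigma : 'I_m -> R) (x' x'' : 'I_m -> X),
      (mixed_lip_norm y0 s q sigma (T \o x') (T \o x'')
       <= C%:E * weak_lip_norm x0 p sigma x' x'')%E].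

(* Lipschitz (m^L(s;q), p)-summing; that T is Lipschitz is a separate hypothesis. *)
Definition mixed_summing (s q p : \bar R) (T : X -> Y) : Prop :=
  exists C : R, mixed_summing_constants s q p T C.

(* pi^L_{(m^L(s;q), p)}(T), equal to +oo when T is not summing *)
Definition mixed_summing_norm (s q p : \bar R) (T : X -> Y) : \bar R :=
  ereal_inf [set C%:E | C in mixed_summing_constants s q p T].

(* The left-hand side is the mixed l_q(l_s) norm
     [sum_j |sigma_j|^q [sum_k |g_k(S x'_j) - g_k(S x''_j)|^s]^(q/s)]^(1/q),
   sums being replaced by suprema for the indices equal to +oo. *)
Definition mixed_domination_constants (s q p : \bar R) (S : X -> Y) : set R :=
  [set C | 0 <= C /\
    forall (m n : nat) (sigma : 'I_m -> R) (x' x'' : 'I_m -> X)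
      (g : 'I_n -> Y -> R), (forall k, lip_dual y0 (g k)) ->
      ((lp_norm q (fun j => sigma j *
          lp_norm s (fun k => g k (S (x' j)) - g k (S (x'' j)))))%:E
       <= C%:E * weak_lip_norm x0 p sigma x' x''
          * (lp_norm s (fun k => Lip (g k)))%:E)%E].

End mixed_summing.

(* Main.v *)
Require Import Defs.
From mathcomp Require Import all_boot all_order all_algebra.
From mathcomp Require Import all_classical all_reals all_analysis.
From mathcomp Require Import ring lra.

(** Fix the pairs (y'_j, y''_j) and the scalars sigma_j.  The theorem reduces to
    a duality formula for the mixed norm: it is the least K such that, for all
    finite families g in Y^#,
      || (sigma_j || (g_k y'_j - g_k y''_j)_k ||_s)_j ||_q
        <= K || (Lip g_k)_k ||_s.
    Applied to y'_j = S x'_j and y''_j = S x''_j, it says that the two families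
    of inequalities admit the same constants ([mixed_constantsE]), and both
    assertions of the theorem follow.

    That the mixed norm is such a K ([lp_norm_le_mixed_lip_norm]) is Hoelder's
    inequality with 1/q = 1/r + 1/s, r = s'(q): for every tau, factor sigma_j as
    tau_j times sigma_j / tau_j, exchange the two l_s norms, and bound the inner
    one by Lip(g_k) times the weak norm of sigma / tau.

    Conversely, let K be such a constant; for each K' > K one has to find
    weights tau giving at most K' ([mixed_lip_norm_le_of_dominated]).  If s = q,
    then tau = 1 does.  If q < s = oo, test K on the functions that measure the
    distance to y''_k; the optimal tau_j is |sigma_j| d(y'_j, y''_j), perturbed
    to be nonzero.  If q < s < oo, consider the vectors
      a_j = sum_k |sigma_j (g_k y'_j - g_k y''_j)|^s,  sum_k Lip(g_k)^s <= 1.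
    They form a convex set, and K bounds on it the concave function
    Phi(a) = sum_j a_j^t, with t = q/s, by K^q.  If b maximizes Phi, the
    first-order condition reads
      sum_j b_j^(t-1) a_j <= sum_j b_j^t   for all a in the set,
    and tau_j = b_j^((1-t)/s) turns its left-hand side, for a given by a single
    function f, into || (sigma_j/tau_j (f y'_j - f y''_j))_j ||_s^s and its
    right-hand side into || tau ||_r^r ([has_weights_fin]).  As the
    set need not be closed, and a maximizer could have zero coordinates, Phi is
    shifted by a small constant and b only nearly maximizes it: the inequalities
    then hold up to an arbitrarily small error ([near_maximizer_weights]). *)

Set Implicit Arguments.
Unset Strict Implicit.
Unset Printing Implicit Defensive.
Import Order.TTheory GRing.Theory Num.Theory.
Local Open Scope classical_set_scope.
Local Open Scope ring_scope.

(** * Concave maximization of power sums *)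

Lemma le_powR (R : realType) (r x y : R) :
  0 <= r -> 0 <= x -> x <= y -> x `^ r <= y `^ r.
Proof.
by move=> r0 x0 xy; rewrite ge0_ler_powR// nnegrE// (le_trans x0).
Qed.

Lemma powRK (R : realType) (r x : R) : r != 0 -> 0 <= x -> (x `^ r) `^ r^-1 = x.
Proof. by move=> r0 x0; rewrite -powRrM mulfV// powRr1. Qed.

Lemma powRVK (R : realType) (r x : R) : r != 0 -> 0 <= x -> (x `^ r^-1) `^ r = x.
Proof. by move=> r0 x0; rewrite -powRrM mulVf// powRr1. Qed.

(** The graph of a concave power lies below its tangent at [c]: this is Young's
    inequality for [(b / c) `^ t] and 1. *)
Lemma powR_le_tangent (R : realType) (t b c : R) : 0 < t < 1 -> 0 < b -> 0 < c ->
  b `^ t <= c `^ t + t * (c `^ (t - 1) * (b - c)).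
Proof.
move=> /andP[t0 t1] b0 c0.
have bc0 : 0 <= b / c by rewrite divr_ge0// ltW.
have ct0 : 0 <= c `^ t by exact: powR_ge0.
have t1' : 0 < 1 - t by rewrite subr_gt0.
have young : (b / c) `^ t <= (b / c) * t + (1 - t).
  have := @conjugate_powR R ((b / c) `^ t) 1 t^-1 (1 - t)^-1 (powR_ge0 _ _) ler01.
  rewrite !invr_gt0 t0 t1' !invrK mulr1 powR1 mul1r powRK// ?gt_eqF//.
  by apply=> //; rewrite addrC subrK.
have -> : b `^ t = c `^ t * (b / c) `^ t.
  by rewrite -powRM ?(ltW c0)// mulrCA mulfV ?mulr1// gt_eqF.
apply: (le_trans (ler_wpM2l ct0 young)).
have -> : c `^ (t - 1) = c `^ t / c.
  by rewrite powRB ?powRr1 ?(ltW c0)//; apply/implyP => _; rewrite gt_eqF.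
by rewrite le_eqVlt; apply/orP; left; apply/eqP; field; rewrite gt_eqF.
Qed.

(** The shares [x / (x + y)] and [y / (x + y)] add up to 1 and each is at most
    its own power of exponent [t <= 1]. *)
Lemma powR_subadditive (R : realType) (t x y : R) : 0 < t <= 1 ->
  0 <= x -> 0 <= y -> (x + y) `^ t <= x `^ t + y `^ t.
Proof.
move=> /andP[t0 t1] x0 y0.
have [xy0|xy0] := eqVneq (x + y) 0.
  by rewrite xy0 powR0 ?gt_eqF// addr_ge0// powR_ge0.
have xyp : 0 < x + y by rewrite lt_neqAle eq_sym xy0 addr_ge0.
have part z : 0 <= z -> z <= x + y -> z / (x + y) * (x + y) `^ t <= z `^ t.
  move=> z0 zxy; have [->|zn0] := eqVneq z 0; first by rewrite mul0r mul0r powR_ge0.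
  have zp : 0 < z by rewrite lt_neqAle eq_sym zn0.
  have zu : 0 <= z / (x + y) by rewrite divr_ge0// ltW.
  rewrite -[in leRHS](divfK xy0 z) powRM ?(ltW xyp)// ler_wpM2r ?powR_ge0//.
  by rewrite ger1_powR// divr_gt0//= ler_pdivrMr// mul1r.
rewrite -[leLHS]mul1r -(mulfV xy0) mulrDl mulrDl lerD// part//.
  by rewrite lerDl.
by rewrite lerDr.
Qed.

(** The error budget of [near_maximizer_weights]: as the step [lam] tends
    to 0, the left-hand side of the last inequality tends to [M]. *)
Lemma first_order_slack (R : realType) (D M M' : R) : 0 <= D -> 0 <= M -> M < M' ->
  exists2 lam : R, 0 < lam < 1 & (1 + lam * D) * (M / (1 - lam) + lam) <= M'.
Proof.
move=> D0 M0 MM'.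
set E := D * M + (1 + D) * (2 * M + 1).
have E0 : 0 < E by rewrite /E; nra.
have d0 : 0 < M' - M by rewrite subr_gt0.
pose lam := Num.min 2^-1 ((M' - M) / E).
have lam0 : 0 < lam by rewrite lt_min divr_gt0// invr_gt0 ltr0n.
have lam2 : lam <= 2^-1 by rewrite ge_min lexx.
have lamE : lam * E <= M' - M by rewrite -ler_pdivlMr// ge_min lexx orbT.
exists lam; first by rewrite lam0/=; lra.
have inv_le : M / (1 - lam) <= M + 2 * lam * M.
  rewrite ler_pdivrMr; last lra.
  have : 0 <= lam * M * (1 - 2 * lam) by rewrite !mulr_ge0 ?(ltW lam0)//; lra.
  lra.
have D1 : 0 <= 1 + lam * D by rewrite addr_ge0// mulr_ge0// ltW.
apply: (@le_trans _ _ ((1 + lam * D) * (M + 2 * lam * M + lam))).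
  by rewrite ler_wpM2l// lerD2r.
have : lam * (lam * D * (2 * M + 1)) <= lam * (D * (2 * M + 1)).
  rewrite ler_pM2l// -mulrA -[leRHS]mul1r ler_wpM2r ?mulr_ge0//; last lra.
  by rewrite addr_ge0// mulr_ge0.
rewrite /E in lamE => lamle; lra.
Qed.

Section near_maximizer.
Context {R : realType} {m : nat}.
Implicit Types (A : set ('I_m -> R)).

(** First-order optimality for the maximization of [\sum_j a j `^ t] over a
    bounded convex set, up to the error [M' - M].  Shift the set by [eps], let
    [b] nearly maximize, with error [t * lam ^+ 2], and compare it with the
    point [c] a fraction [lam] of the way from [b] to a competitor.  The tangent
    at [c] bounds the gain from below, so that the slope at [c], up to the
    factor [t], is at most [lam]; since [(1 - lam) b <= c <= (1 + lam * (`|B| / eps)) b], the powers of [c] can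
    be replaced by those of [b]. *)
Lemma near_maximizer_weights A (t B M M' : R) :
  0 < t < 1 -> M < M' -> A !=set0 ->
  (forall a, A a -> forall j, 0 <= a j <= B) ->
  (forall lam a a', 0 < lam < 1 -> A a -> A a' ->
     A (fun j => (1 - lam) * a j + lam * a' j)) ->
  (forall a, A a -> \sum_(j < m) a j `^ t <= M) ->
  exists b : 'I_m -> R, [/\ forall j, 0 < b j,
    \sum_(j < m) b j `^ t <= M' &
    forall a, A a -> \sum_(j < m) b j `^ (t - 1) * a j <= M'].
Proof.
move=> t01 MM' [a0 Aa0] AB Acvx AM; have /andP[t0 t1] := t01.
have M0 : 0 <= M by apply: le_trans (AM _ Aa0); apply: sumr_ge0 => j _; exact: powR_ge0.
have a_ge0 a j : A a -> 0 <= a j by move=> /AB /(_ j) /andP[].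
(* The shift keeps b away from 0, where t-th powers are not differentiable; it
   costs at most m * eps ^ t <= (M' - M) / 2. *)
pose eps := ((M' - M) / 2 / m.+1%:R) `^ t^-1.
have d0 : 0 < M' - M by rewrite subr_gt0.
have eps0 : 0 < eps by rewrite powR_gt0// !divr_gt0.
pose Phi (a : 'I_m -> R) := \sum_(j < m) (a j + eps) `^ t.
pose M1 := (M + M') / 2.
have M1M' : M1 < M' by rewrite /M1; lra.
have PhiM1 a : A a -> Phi a <= M1.
  move=> Aa; apply: (@le_trans _ _ (\sum_(j < m) (a j `^ t + eps `^ t))).
    apply: ler_sum => j _; apply: powR_subadditive; [by rewrite t0 ltW|exact: a_ge0|exact: ltW].
  rewrite big_split/= sumr_const card_ord.
  rewrite (_ : M1 = M + (M' - M) / 2); last by rewrite /M1; field.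
  rewrite lerD ?AM// /eps powRVK ?gt_eqF//; last first.
    by rewrite !divr_ge0// ltW.
  rewrite -[leLHS]mulr_natr mulrAC ler_pdivrMr ?ltr0n//.
  by rewrite ler_wpM2l ?ler_nat// divr_ge0// ltW.
have PhiS : has_sup [set Phi a | a in A].
  split; first by exists (Phi a0), a0.
  by exists M1 => _ [a Aa <-]; exact: PhiM1.
set M2 := sup [set Phi a | a in A].
have PhiM2 a : A a -> Phi a <= M2.
  by move=> Aa; apply: ub_le_sup; [exact: PhiS.2|exists a].
have M2M' : M2 < M'.
  apply: le_lt_trans M1M'; apply: ge_sup; first exact: PhiS.1.
  by move=> _ [a Aa <-]; exact: PhiM1.
have Phi0 a : 0 <= Phi a by apply: sumr_ge0 => j _; exact: powR_ge0.
have M20 : 0 <= M2 by exact: le_trans (PhiM2 _ Aa0).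
have D0 : 0 <= `|B| / eps by rewrite divr_ge0// ltW.
have [lam /andP[lam0 lam1] lamM'] := @first_order_slack _ _ _ _ D0 M20 M2M'.
have lam1' : 0 < 1 - lam by rewrite subr_gt0.
have eta0 : 0 < t * lam ^+ 2 by rewrite mulr_gt0// exprn_gt0.
have [_ [a Aa <-] aM2] := sup_adherent eta0 PhiS.
pose b j := a j + eps.
have b0 j : 0 < b j by rewrite /b ltr_wpDl// a_ge0.
exists b; split=> //; first by rewrite (le_trans (PhiM2 a Aa))// ltW.
move=> a' Aa'; pose b' j := a' j + eps.
have b'0 j : 0 < b' j by rewrite /b' ltr_wpDl// a_ge0.
pose c j := (1 - lam) * b j + lam * b' j.
have c0 j : 0 < c j by rewrite addr_gt0// mulr_gt0.
have cM2 : \sum_(j < m) c j `^ t <= M2.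
  have -> : \sum_(j < m) c j `^ t = Phi (fun j => (1 - lam) * a j + lam * a' j).
    by apply: eq_bigr => j _; congr (_ `^ _); rewrite /c /b /b'; ring.
  by apply: PhiM2; apply: Acvx => //; rewrite lam0.
(* As b - c = lam * (b - b'), the tangent at c, evaluated at b, turns the gain
   t * lam ^ 2 still possible at b into this bound on the slope. *)
have slope : \sum_(j < m) c j `^ (t - 1) * b' j <=
             (\sum_(j < m) c j `^ (t - 1) * b j) + lam.
  have : Phi a <= (\sum_(j < m) c j `^ t) +
      t * \sum_(j < m) c j `^ (t - 1) * (b j - c j).
    rewrite mulr_sumr -big_split; apply: ler_sum => j _.
    exact: powR_le_tangent t01 (b0 j) (c0 j).
  have -> : \sum_(j < m) c j `^ (t - 1) * (b j - c j) =
      lam * ((\sum_(j < m) c j `^ (t - 1) * b j) -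
             \sum_(j < m) c j `^ (t - 1) * b' j).
    rewrite -sumrB mulr_sumr; apply: eq_bigr => j _; rewrite /c; ring.
  set P := \sum_(j < m) _ * b j; set P' := \sum_(j < m) _ * b' j => h.
  have : t * lam * (P' - P) <= t * lam * lam.
    have -> : t * lam * lam = t * lam ^+ 2 by ring.
    have -> : t * lam * (P' - P) = - (t * (lam * (P - P'))) by ring.
    move: aM2 h cM2; rewrite /M2; lra.
  by rewrite ler_pM2l ?mulr_gt0// lerBlDl.
have Phib : \sum_(j < m) c j `^ (t - 1) * b j <= M2 / (1 - lam).
  rewrite ler_pdivlMr//; apply: le_trans (PhiM2 _ Aa).
  rewrite mulr_suml; apply: ler_sum => j _.
  rewrite -/(b j) -[leRHS](@mulr_powRB1 _ _ t) ?(ltW (b0 j))//.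
  rewrite -mulrA mulrC -mulrA ler_pM2l//.
  (* From (1 - lam) * b <= c, as 1 - lam <= (1 - lam) ^ (1 - t). *)
  rewrite (_ : t - 1 = - (1 - t)); last by rewrite opprB.
  rewrite !powRN ler_pdivrMr ?powR_gt0// mulrC ler_pdivlMr ?powR_gt0//.
  apply: (@le_trans _ _ ((1 - lam) `^ (1 - t) * b j `^ (1 - t))).
    rewrite ler_wpM2r ?powR_ge0// ger1_powR// ?lam1'/=; lra.
  rewrite -powRM ?(ltW lam1') ?(ltW (b0 j))// le_powR ?subr_ge0 ?(ltW t1)//.
    by rewrite mulr_ge0// ltW.
  by rewrite /c lerDl mulr_ge0// ltW.
have Phib' : \sum_(j < m) b j `^ (t - 1) * a' j <=
    (1 + lam * (`|B| / eps)) * \sum_(j < m) c j `^ (t - 1) * b' j.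
  rewrite mulr_sumr; apply: ler_sum => j _.
  set k := 1 + _.
  have k1 : 1 <= k by rewrite lerDl mulr_ge0// ltW.
  have k0 : 0 < k by rewrite (lt_le_trans ltr01).
  (* From c <= k * b, as k ^ (1 - t) <= k. *)
  rewrite mulrA ler_pM ?powR_ge0 ?a_ge0//; last by rewrite /b' lerDl ltW.
  rewrite (_ : t - 1 = - (1 - t)); last by rewrite opprB.
  rewrite !powRN ler_pdivlMr ?powR_gt0// mulrC ler_pdivrMr ?powR_gt0//.
  apply: (@le_trans _ _ (k `^ (1 - t) * b j `^ (1 - t))); last first.
    by rewrite ler_wpM2r ?powR_ge0// ler1_powR//; lra.
  rewrite -powRM ?(ltW k0) ?(ltW (b0 j))// le_powR ?subr_ge0 ?(ltW t1) ?(ltW (c0 j))//.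
  have ca : c j <= b j + lam * `|B|.
    have /andP[_ a'B] := AB _ Aa' j; have := a_ge0 a j Aa => aj0.
    have : lam * (a' j - a j) <= lam * `|B|.
      by rewrite ler_pM2l//; have := ler_norm B; lra.
    by rewrite /c /b /b'; lra.
  apply: (le_trans ca).
  rewrite /k mulrDl mul1r lerD2l -mulrA ler_pM2l//.
  by rewrite mulrAC ler_pdivlMr// ler_wpM2l// /b lerDr a_ge0.
apply: (le_trans Phib'); apply: le_trans lamM'.
rewrite ler_wpM2l ?addr_ge0 ?(mulr_ge0 (ltW lam0) D0)//.
by rewrite (le_trans slope)// lerD2r.
Qed.

End near_maximizer.

(** * Finite l_p norms and their mixed index *)

Section finite_lp_norms.
Context {R : realType}.
Implicit Types (p q s : \bar R) (n m : nat).

Lemma lp_norm_ge0 p n (a : 'I_n -> R) : 0 <= lp_norm p a.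
Proof.
case: p => [r| |] /=; first exact: powR_ge0.
all: by apply: bigmax_ge_id.
Qed.

Lemma powR_lp_norm (r : R) n (a : 'I_n -> R) : 0 < r ->
  lp_norm r%:E a `^ r = \sum_(i < n) `|a i| `^ r.
Proof.
move=> r0; rewrite /lp_norm powRVK ?gt_eqF//.
by apply: sumr_ge0 => i _; exact: powR_ge0.
Qed.

Lemma lp_norm_fin_le (r : R) n (a : 'I_n -> R) (c : R) : 0 < r -> 0 <= c ->
  (lp_norm r%:E a <= c) = (\sum_(i < n) `|a i| `^ r <= c `^ r).
Proof.
move=> r0 c0; rewrite -powR_lp_norm//; apply/idP/idP => [|h].
  by apply: le_powR; rewrite ?(ltW r0)// lp_norm_ge0.
rewrite leNgt; apply/negP => /(gt0_ltr_powR r0); rewrite !nnegrE c0 lp_norm_ge0.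
by move=> /(_ isT isT); rewrite ltNge h.
Qed.

Lemma lp_norm_infty_le n (a : 'I_n -> R) (c : R) : 0 <= c ->
  (forall i, `|a i| <= c) -> lp_norm +oo a <= c.
Proof. by move=> c0 ac; apply: bigmax_le => // i _; exact: ac. Qed.

Lemma le_lp_norm_coord p n (a : 'I_n -> R) i : (0 < p)%E -> `|a i| <= lp_norm p a.
Proof.
case: p => [r| |]//; last by move=> _; exact: le_bigmax.
rewrite lte_fin => r0; rewrite -(@powRK _ r `|a i|) ?gt_eqF//.
rewrite /lp_norm le_powR ?invr_ge0 ?(ltW r0) ?powR_ge0//.
by rewrite (bigD1 i)//= lerDl; apply: sumr_ge0 => j _; exact: powR_ge0.
Qed.

Lemma lp_norm_eq0 p n (a : 'I_n -> R) : (0 < p)%E ->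
  lp_norm p a = 0 -> forall i, a i = 0.
Proof.
move=> p0 a0 i; apply/eqP; rewrite -normr_le0 -a0.
exact: le_lp_norm_coord.
Qed.

Lemma le_lp_norm p n (a b : 'I_n -> R) : (0 < p)%E ->
  (forall i, `|a i| <= `|b i|) -> lp_norm p a <= lp_norm p b.
Proof.
move=> p0 ab; case: p p0 => [r r0|_|//].
  rewrite lp_norm_fin_le ?lp_norm_ge0// powR_lp_norm//.
  by apply: ler_sum => i _; rewrite le_powR// ltW.
apply: lp_norm_infty_le => [|i]; first exact: lp_norm_ge0.
by rewrite (le_trans (ab i))// le_lp_norm_coord.
Qed.

Lemma lp_norm0 p n (a : 'I_n -> R) : (0 < p)%E -> (forall i, a i = 0) -> lp_norm p a = 0.
Proof.
move=> p0 a0; apply/eqP; rewrite eq_le lp_norm_ge0 andbT.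
case: p p0 => [r p0|p0|//]; last by apply: lp_norm_infty_le => // i; rewrite a0 normr0.
rewrite lp_norm_fin_le// big1 ?powR_ge0// => i _.
by rewrite a0 normr0 powR0// gt_eqF.
Qed.

Lemma lp_normZ p n (c : R) (a : 'I_n -> R) : (0 < p)%E ->
  lp_norm p (fun i => c * a i) = `|c| * lp_norm p a.
Proof.
move=> p0.
have Zle d (b : 'I_n -> R) : lp_norm p (fun i => d * b i) <= `|d| * lp_norm p b.
  have db0 : 0 <= `|d| * lp_norm p b by rewrite mulr_ge0// lp_norm_ge0.
  case: p p0 db0 => [r p0 db0|p0 db0|//]; last first.
    apply: lp_norm_infty_le => // i.
    by rewrite normrM ler_wpM2l// le_lp_norm_coord.
  rewrite lp_norm_fin_le// powRM ?lp_norm_ge0// powR_lp_norm// mulr_sumr.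
  by apply: ler_sum => i _; rewrite normrM powRM.
apply/eqP; rewrite eq_le Zle/=.
have [->|c0] := eqVneq c 0; first by rewrite normr0 mul0r lp_norm_ge0.
rewrite mulrC -ler_pdivlMr ?normr_gt0// mulrC -normfV.
apply: le_trans (Zle _ _); apply: le_lp_norm => // i.
by rewrite mulKf.
Qed.

Lemma lp_norm_ord1 p (a : 'I_1 -> R) : (0 < p)%E -> lp_norm p a = `|a ord0|.
Proof.
case: p => [r p0|p0|//]; first by rewrite /lp_norm big_ord1 powRK ?gt_eqF.
apply/eqP; rewrite eq_le le_lp_norm_coord// andbT.
by apply: lp_norm_infty_le => // i; rewrite ord1.
Qed.

(** For equal inner and outer indices, the iterated norm is the norm of the whole
    array; this is where the proof needs the index [s] for both the [g_k] and
    the weak norm. *)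
Lemma exchange_lp_norm p m n (M : 'I_m -> 'I_n -> R) : (0 < p)%E ->
  lp_norm p (fun j => lp_norm p (M j)) =
  lp_norm p (fun k => lp_norm p (fun j => M j k)).
Proof.
case: p => [r r0|_|//].
  have powE m' n' (N : 'I_m' -> 'I_n' -> R) :
      lp_norm r%:E (fun j => lp_norm r%:E (N j)) `^ r =
      \sum_(j < m') \sum_(k < n') `|N j k| `^ r.
    rewrite powR_lp_norm//; apply: eq_bigr => j _.
    by rewrite ger0_norm ?lp_norm_ge0// powR_lp_norm.
  apply: (powR_injective r0); rewrite ?nnegrE; try exact: lp_norm_ge0.
  by rewrite powE exchange_big (powE _ _ (fun k j => M j k)).
have le m' n' (N : 'I_m' -> 'I_n' -> R) :
    lp_norm +oo (fun j => lp_norm +oo (N j)) <=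
    lp_norm +oo (fun k => lp_norm +oo (fun j => N j k)).
  apply: lp_norm_infty_le => [|j]; first exact: lp_norm_ge0.
  rewrite ger0_norm ?lp_norm_ge0//.
  apply: lp_norm_infty_le => [|k]; first exact: lp_norm_ge0.
  apply: le_trans (@le_lp_norm_coord +oo _
    (fun k => lp_norm +oo (fun j => N j k)) k (ltry 0)).
  rewrite [leRHS]ger0_norm ?lp_norm_ge0//.
  exact: (@le_lp_norm_coord +oo _ (fun j => N j k) j (ltry 0)).
by apply/eqP; rewrite eq_le; apply/andP; split; exact: le.
Qed.

(** The arguments are [q], [s] and [s'(q)]. *)
Variant mixed_index_spec : \bar R -> \bar R -> \bar R -> Prop :=
| MixedIndexDiag q : (0 < q)%E -> mixed_index_spec q q +oo
| MixedIndexInfty (u : R) : 0 < u -> mixed_index_spec u%:E +oo u%:E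
| MixedIndexFin (u v r : R) : 0 < u -> u < v -> 0 < r -> u^-1 = r^-1 + v^-1 ->
    mixed_index_spec u%:E v%:E r%:E.

Lemma mixed_index_cases q s : (0 < q)%E -> (q <= s)%E ->
  mixed_index_spec q s (mixed_index s q).
Proof.
case: q s => [u| |] [v| |]// q0 qs; rewrite /mixed_index; last first.
- by rewrite invey sube0 inve0; exact: MixedIndexDiag.
- rewrite invey sube0 inveK; exact: MixedIndexInfty.
move: q0 qs; rewrite lte_fin lee_fin => u0; rewrite le_eqVlt => /orP[/eqP<-|uv].
  rewrite inver gt_eqF// subee// inve0; exact: MixedIndexDiag.
have v0 : 0 < v by exact: lt_trans uv.
have uv' : 0 < u^-1 - v^-1 by rewrite subr_gt0 ltf_pV2.
rewrite !inver !gt_eqF// -EFinB inver gt_eqF//; apply: MixedIndexFin => //.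
  by rewrite invr_gt0.
by rewrite invrK subrK.
Qed.

(** In the finite case, Young's inequality with the conjugate exponents [r / u]
    and [v / u], summed after normalizing both factors. *)
Lemma lp_norm_hoelder q s n (a b : 'I_n -> R) : (0 < q)%E -> (q <= s)%E ->
  lp_norm q (fun i => a i * b i) <= lp_norm (mixed_index s q) a * lp_norm s b.
Proof.
move=> + qs => q0; case: (mixed_index_cases q0 qs) => {q0 qs}[{}q q0|u u0|u v r u0 uv r0 uvr].
- apply: (@le_trans _ _ (lp_norm q (fun i => lp_norm +oo a * b i))).
    apply: le_lp_norm => [//|i]; rewrite !normrM; apply: ler_wpM2r; first exact: normr_ge0.
    rewrite [leRHS]ger0_norm ?lp_norm_ge0//.
    exact: (@le_lp_norm_coord +oo _ a i (ltry 0)).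
  by rewrite lp_normZ// ger0_norm ?lp_norm_ge0.
- apply: (@le_trans _ _ (lp_norm u%:E (fun i => lp_norm +oo b * a i))).
    apply: le_lp_norm => [//|i]; rewrite !normrM mulrC; apply: ler_wpM2r; first exact: normr_ge0.
    rewrite [leRHS]ger0_norm ?lp_norm_ge0//.
    exact: (@le_lp_norm_coord +oo _ b i (ltry 0)).
  by rewrite lp_normZ// ger0_norm ?lp_norm_ge0// mulrC.
have v0 : 0 < v by exact: lt_trans uv.
have [Az|An] := eqVneq (lp_norm r%:E a) 0.
  by rewrite Az mul0r lp_norm0// => i; rewrite (lp_norm_eq0 _ Az)// mul0r.
have [Bz|Bn] := eqVneq (lp_norm v%:E b) 0.
  by rewrite Bz mulr0 lp_norm0// => i; rewrite (lp_norm_eq0 _ Bz)// mulr0.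
have unit_sum (w : R) (c : 'I_n -> R) : 0 < w -> 0 < lp_norm w%:E c ->
    \sum_(i < n) (`|c i| / lp_norm w%:E c) `^ w = 1.
  move=> w0 c0; under eq_bigr do rewrite powRM ?invr_ge0 ?(ltW c0)//.
  rewrite -mulr_suml -powR_lp_norm// -powRM ?invr_ge0 ?lp_norm_ge0//.
  by move: (lp_norm _ _) c0 => N c0; rewrite mulfV ?powR1// gt_eqF.
have Ap : 0 < lp_norm r%:E a by rewrite lt_neqAle eq_sym An lp_norm_ge0.
have Bp : 0 < lp_norm v%:E b by rewrite lt_neqAle eq_sym Bn lp_norm_ge0.
rewrite lp_norm_fin_le ?mulr_ge0 ?lp_norm_ge0//.
move: (unit_sum _ _ r0 Ap) (unit_sum _ _ v0 Bp) => {unit_sum}.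
move: (lp_norm r%:E a) (lp_norm v%:E b) An Bn Ap Bp => A B An Bn Ap Bp Asum Bsum.
rewrite powRM ?(ltW Ap) ?(ltW Bp)//.
have young i : (`|a i| / A) `^ u * (`|b i| / B) `^ u <=
    u / r * (`|a i| / A) `^ r + u / v * (`|b i| / B) `^ v.
  have conj1 : (r / u)^-1 + (v / u)^-1 = 1.
    by rewrite !invf_div -mulrDr -uvr mulfV// gt_eqF.
  have := conjugate_powR (powR_ge0 (`|a i| / A) u) (powR_ge0 (`|b i| / B) u)
            (divr_gt0 r0 u0) (divr_gt0 v0 u0) conj1.
  have cancel w : u * (w / u) = w by rewrite mulrCA mulfV ?mulr1// gt_eqF.
  by rewrite -!powRrM !cancel !invf_div ![_ `^ _ * (u / _)]mulrC.
have -> : \sum_(i < n) `|a i * b i| `^ u =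
    A `^ u * B `^ u * \sum_(i < n) (`|a i| / A) `^ u * (`|b i| / B) `^ u.
  rewrite mulr_sumr; apply: eq_bigr => i _.
  rewrite -!powRM ?mulr_ge0 ?invr_ge0 ?(ltW Ap) ?(ltW Bp)//; congr (_ `^ _).
  by rewrite normrM; field; rewrite An Bn.
rewrite ler_piMr ?mulr_ge0 ?powR_ge0//.
apply: (le_trans (ler_sum _ (fun i _ => young i))).
rewrite big_split/= -!mulr_sumr Asum Bsum !mulr1 -mulrDr -uvr.
by rewrite mulfV// gt_eqF.
Qed.

End finite_lp_norms.

(** * Lipschitz functions and weak norms *)

Section lipschitz_functions.
Context {R : realType} {X : metricType R}.
Implicit Types (f : X -> R) (x y z : X).

Lemma Lip_ge0 f : 0 <= Lip f.
Proof.
rewrite /Lip; have [->|/set0P fne] := eqVneq (lip_constants f) set0.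
  by rewrite inf0.
by apply: lb_le_inf => // K [].
Qed.

Lemma Lip_le f K : lip_constants f K -> Lip f <= K.
Proof. by apply: ge_inf; exists 0 => ? []. Qed.

Lemma le_Lip_mdist f x y : lip_constants f !=set0 ->
  `|f x - f y| <= Lip f * mdist x y.
Proof.
move=> fne; have [->|xy] := eqVneq x y; first by rewrite subrr normr0 mdistxx mulr0.
have d0 : 0 < mdist x y by rewrite mdist_gt0.
rewrite -ler_pdivrMr//; apply: lb_le_inf => // K [_ fK].
by rewrite ler_pdivrMr.
Qed.

Lemma lip_dualZ x0 f (c : R) : lip_dual x0 f -> lip_dual x0 (fun x => c * f x).
Proof.
move=> [f0 [K [K0 fK]]]; split; first by rewrite f0 mulr0.
exists (`|c| * K); split=> [|x y]; first by rewrite mulr_ge0.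
by rewrite -mulrBr normrM -mulrA ler_wpM2l.
Qed.

Lemma LipZ_le x0 f (c : R) : lip_dual x0 f -> Lip (fun x => c * f x) <= `|c| * Lip f.
Proof.
move=> [_ fne]; apply: Lip_le; split=> [|x y]; first by rewrite mulr_ge0// Lip_ge0.
by rewrite -mulrBr normrM -mulrA ler_wpM2l// le_Lip_mdist.
Qed.

Lemma lip_dual_ball_mdist x0 z : lip_dual_ball x0 (fun x => mdist x z - mdist x0 z).
Proof.
have K1 : lip_constants (fun x => mdist x z - mdist x0 z) 1.
  split=> // x y; rewrite mul1r ler_norml.
  have := metric_triangle x y z; have := metric_triangle y x z.
  by rewrite (metric_sym y x) => ? ?; apply/andP; split; lra.
split; last exact: Lip_le.
by split; [rewrite subrr|exists 1].
Qed.

End lipschitz_functions.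

Section weak_norms.
Context {R : realType} {X : metricType R}.
Implicit Types (p q s : \bar R) (x y z : X).

Lemma weak_lip_norm_ge0 x p m (sigma : 'I_m -> R) (x' x'' : 'I_m -> X) :
  (0 <= weak_lip_norm x p sigma x' x'')%E.
Proof.
have := lip_dual_ball_mdist x x.
set f := (X in lip_dual_ball _ X) => fball.
apply: (@le_trans _ _ (lp_norm p (fun j => sigma j * (f (x' j) - f (x'' j))))%:E).
  by rewrite lee_fin lp_norm_ge0.
by apply: ereal_sup_ubound; exists f.
Qed.

Lemma weak_lip_norm_le x p m (sigma : 'I_m -> R) (x' x'' : 'I_m -> X) (c : R) :
  (forall f, lip_dual_ball x f ->
    lp_norm p (fun j => sigma j * (f (x' j) - f (x'' j))) <= c) ->
  (weak_lip_norm x p sigma x' x'' <= c%:E)%E.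
Proof.
by move=> fc; apply: ge_ereal_sup => _ [f /fc fle <-]; rewrite lee_fin.
Qed.

(** The distances dominate the increments of all functions of the unit ball. *)
Lemma weak_lip_norm_fin_num x p m (sigma : 'I_m -> R) (x' x'' : 'I_m -> X) :
  (0 < p)%E -> weak_lip_norm x p sigma x' x'' \is a fin_num.
Proof.
move=> p0; rewrite ge0_fin_numE ?weak_lip_norm_ge0//.
apply: le_lt_trans (ltry (lp_norm p (fun j => sigma j * mdist (x' j) (x'' j)))).
apply: weak_lip_norm_le => f [[_ fne] f1]; apply: le_lp_norm => [//|j].
rewrite !normrM ler_wpM2l// (ger0_norm (mdist_ge0 _ _)).
by apply: (le_trans (le_Lip_mdist _ _ fne)); rewrite ler_piMl// mdist_ge0.
Qed.

(** Normalize [f]; if [Lip f = 0], its increments vanish. *)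
Lemma lp_norm_le_weak_lip_norm x p m (sigma : 'I_m -> R) (x' x'' : 'I_m -> X)
    (f : X -> R) : (0 < p)%E -> lip_dual x f ->
  lp_norm p (fun j => sigma j * (f (x' j) - f (x'' j))) <=
  Lip f * fine (weak_lip_norm x p sigma x' x'').
Proof.
move=> p0 fdual; have [_ fne] := fdual.
have [L0|Ln] := eqVneq (Lip f) 0.
  rewrite L0 mul0r lp_norm0// => j; apply/eqP.
  have := le_Lip_mdist (x' j) (x'' j) fne.
  by rewrite L0 mul0r normr_le0 => /eqP ->; rewrite mulr0.
have Lp : 0 < Lip f by rewrite lt_neqAle eq_sym Ln Lip_ge0.
pose g := fun z => (Lip f)^-1 * f z.
have gball : lip_dual_ball x g.
  split; first exact: lip_dualZ.
  apply: (le_trans (LipZ_le _ fdual)).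
  by rewrite ger0_norm ?invr_ge0 ?Lip_ge0// mulVf.
rewrite -ler_pdivrMl// -[in leLHS](gtr0_norm Lp) -normfV -lp_normZ//.
rewrite -lee_fin fineK ?weak_lip_norm_fin_num//.
apply: ereal_sup_ubound; exists g => //; congr ((lp_norm _ _)%:E).
by apply/funext => j; rewrite /g -mulrBr mulrCA.
Qed.

Lemma mixed_lip_norm_le x s q m (sigma : 'I_m -> R) (x' x'' : 'I_m -> X)
    (tau : 'I_m -> R) (A B : R) : 0 <= A -> 0 <= B -> (forall j, tau j != 0) ->
  lp_norm (mixed_index s q) tau <= A ->
  (forall f, lip_dual_ball x f ->
    lp_norm s (fun j => sigma j / tau j * (f (x' j) - f (x'' j))) <= B) ->
  (mixed_lip_norm x s q sigma x' x'' <= (A * B)%:E)%E.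
Proof.
move=> A0 B0 tau0 tauA fB; rewrite EFinM.
apply: (@le_trans _ _ ((lp_norm (mixed_index s q) tau)%:E *
  weak_lip_norm x s (fun j => sigma j / tau j)%R x' x'')%E).
  by apply: ereal_inf_lbound; exists tau.
rewrite lee_pmul ?weak_lip_norm_ge0 ?lee_fin ?lp_norm_ge0//.
exact: weak_lip_norm_le.
Qed.

(** The Hoelder half of the duality formula. *)
Lemma lp_norm_le_mixed_lip_norm x s q m n (sigma : 'I_m -> R)
    (x' x'' : 'I_m -> X) (g : 'I_n -> X -> R) :
  (0 < q)%E -> (q <= s)%E -> (forall k, lip_dual x (g k)) ->
  ((lp_norm q (fun j => sigma j *
      lp_norm s (fun k => g k (x' j) - g k (x'' j))))%:E
   <= mixed_lip_norm x s q sigma x' x'' * (lp_norm s (fun k => Lip (g k)))%:E)%E.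
Proof.
move=> q0 qs gdual; have s0 := lt_le_trans q0 qs.
set L := lp_norm q _; set N := lp_norm s _.
have N0 : 0 <= N := lp_norm_ge0 _ _.
have tau_le (tau : 'I_m -> R) : (forall j, tau j != 0) ->
    L <= lp_norm (mixed_index s q) tau *
         fine (weak_lip_norm x s (fun j => sigma j / tau j) x' x'') * N.
  move=> tau0; set w := fine _.
  have w0 : 0 <= w by rewrite fine_ge0// weak_lip_norm_ge0.
  have -> : L = lp_norm q (fun j => tau j * (sigma j / tau j *
      lp_norm s (fun k => g k (x' j) - g k (x'' j)))).
    congr (lp_norm _ _); apply/funext => j.
    by rewrite mulrA mulrCA mulfV// mulr1.
  apply: (le_trans (lp_norm_hoelder tau _ q0 qs)).
  rewrite -mulrA ler_wpM2l ?lp_norm_ge0//.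
  pose h j k := sigma j / tau j * (g k (x' j) - g k (x'' j)).
  apply: (@le_trans _ _ (lp_norm s (fun j => lp_norm s (h j)))).
    apply: le_lp_norm => [//|j]; rewrite [lp_norm s (h j)]lp_normZ//.
    by rewrite normrM [leRHS]normrM normr_id.
  rewrite exchange_lp_norm// -[X in X * N]ger0_norm// -lp_normZ//.
  apply: le_lp_norm => [//|k].
  rewrite [leLHS]ger0_norm ?lp_norm_ge0// ger0_norm ?mulr_ge0 ?Lip_ge0//.
  by rewrite mulrC; apply: lp_norm_le_weak_lip_norm.
have [Nz|Nn] := eqVneq N 0.
  rewrite Nz mule0 lee_fin.
  by have := tau_le (fun=> 1) (fun=> oner_neq0 _); rewrite Nz mulr0.
have Np : 0 < N by rewrite lt_neqAle eq_sym Nn N0.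
rewrite -lee_pdivrMr//; apply: le_ereal_inf_tmp => _ [tau tau0 <-].
rewrite -[weak_lip_norm _ _ _ _ _]fineK ?weak_lip_norm_fin_num//.
by rewrite -!EFinM lee_fin ler_pdivrMr// tau_le.
Qed.

End weak_norms.

(** * Construction of the weights *)

Section weights.
Context {R : realType} {X : metricType R}.
Implicit Types (p q s r : \bar R) (x y z : X).

Definition dominated_by x s q m (sigma : 'I_m -> R) (x' x'' : 'I_m -> X) (K : R) :=
  forall n (g : 'I_n -> X -> R), (forall k, lip_dual x (g k)) ->
    lp_norm q (fun j => sigma j * lp_norm s (fun k => g k (x' j) - g k (x'' j)))
    <= K * lp_norm s (fun k => Lip (g k)).

(** Weights [tau] witnessing that the mixed norm is at most [K]; [r] stands for
    [s'(q)]. *)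
Definition has_weights x r s m (sigma : 'I_m -> R) (x' x'' : 'I_m -> X) (K : R) :=
  exists (tau : 'I_m -> R) (A B : R), [/\ 0 <= A, 0 <= B & A * B <= K] /\
    [/\ forall j, tau j != 0, lp_norm r tau <= A &
     forall f, lip_dual_ball x f ->
       lp_norm s (fun j => sigma j / tau j * (f (x' j) - f (x'' j))) <= B].

Lemma has_weights_diag x q m (sigma : 'I_m -> R) (x' x'' : 'I_m -> X) (K : R) :
  (0 < q)%E -> 0 <= K -> dominated_by x q q sigma x' x'' K ->
  has_weights x +oo q sigma x' x'' K.
Proof.
move=> q0 K0 dom; exists (fun=> 1), 1, K; split; first by rewrite mul1r.
split=> [j| |f [fdual f1]]; first exact: oner_neq0.
  by apply: lp_norm_infty_le => // i; rewrite normr1.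
have := dom 1 (fun=> f) (fun=> fdual).
rewrite [lp_norm q (fun=> Lip f)]lp_norm_ord1// (ger0_norm (Lip_ge0 _)) => h.
apply: (@le_trans _ _ (K * Lip f)); last by rewrite ler_piMr.
apply: le_trans h; apply: le_lp_norm => [//|j].
by rewrite divr1 !normrM lp_norm_ord1// normr_id.
Qed.

(** The weights are governed by the sup over the unit ball of each increment
    separately, that is the distance [mdist (x' j) (x'' j)]; [eta] is the
    perturbation that makes them nonzero. *)
Lemma has_weights_infty x (u : R) m (sigma : 'I_m -> R) (x' x'' : 'I_m -> X)
    (K K' : R) : 0 < u -> 0 <= K -> K < K' ->
  dominated_by x +oo u%:E sigma x' x'' K ->
  has_weights x u%:E +oo sigma x' x'' K'.
Proof.
move=> u0 K0 KK' dom; have K'0 : 0 < K' by exact: le_lt_trans KK'.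
pose a j := `|sigma j| * mdist (x' j) (x'' j).
have a0 j : 0 <= a j by rewrite mulr_ge0// mdist_ge0.
pose g (k : 'I_m) := fun z => mdist z (x'' k) - mdist x (x'' k).
have gball k : lip_dual_ball x (g k) by exact: lip_dual_ball_mdist.
have aK : \sum_(j < m) a j `^ u <= K `^ u.
  have := dom _ g (fun k => (gball k).1).
  have N1 : lp_norm +oo (fun k => Lip (g k)) <= 1.
    apply: lp_norm_infty_le => // k; rewrite ger0_norm ?Lip_ge0//.
    exact: (gball k).2.
  move=> h; have := le_trans h (ler_wpM2l K0 N1).
  rewrite mulr1 lp_norm_fin_le//; apply: le_trans; apply: ler_sum => j _.
  apply: le_powR; [exact: ltW|exact: a0|].
  rewrite normrM ler_wpM2l// [leRHS]ger0_norm ?lp_norm_ge0//.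
  (* The supremum over k is bounded below by its term k = j. *)
  apply: le_trans (@le_lp_norm_coord _ +oo _
    (fun k => g k (x' j) - g k (x'' j)) j (ltry 0)).
  by rewrite /g mdistxx sub0r opprK addrNK ler_norm.
pose eta := (K' `^ u - K `^ u) / m.+1%:R.
have eta0 : 0 < eta.
  by rewrite divr_gt0// subr_gt0 gt0_ltr_powR// nnegrE// ltW.
have au0 j : 0 < a j `^ u + eta by rewrite ltr_wpDl// powR_ge0.
pose tau j := (a j `^ u + eta) `^ u^-1.
have tau0 j : 0 < tau j by rewrite powR_gt0.
exists tau, K', 1; split; first by rewrite mulr1 ltW.
split=> [j| |f [[_ fne] f1]]; first by rewrite gt_eqF.
  rewrite lp_norm_fin_le ?(ltW K'0)//.
  under eq_bigr do rewrite ger0_norm ?(ltW (tau0 _))// powRVK ?gt_eqF// ?(ltW (au0 _))//.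
  rewrite big_split/= sumr_const card_ord.
  apply: (@le_trans _ _ (K `^ u + (K' `^ u - K `^ u))); last by rewrite addrC subrK.
  rewrite lerD// -[leLHS]mulr_natr mulrAC ler_pdivrMr ?ltr0n//.
  rewrite ler_wpM2l ?ler_nat// subr_ge0 le_powR ?(ltW u0) ?(ltW KK')//.
apply: lp_norm_infty_le => // j.
rewrite !normrM normfV (gtr0_norm (tau0 j)) mulrAC ler_pdivrMr// mul1r.
apply: (@le_trans _ _ (a j)).
  rewrite ler_wpM2l//; apply: (le_trans (le_Lip_mdist _ _ fne)).
  by rewrite ler_piMl// mdist_ge0.
rewrite -[leLHS](@powRK _ u) ?gt_eqF// le_powR ?invr_ge0 ?(ltW u0) ?powR_ge0//.
by rewrite lerDl ltW.
Qed.

(** The families [g] are those of norm at most 1 in [l_v(X^#)]; allowing several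
    functions, rather than one, is what makes this set convex. *)
Definition test_vectors x (v : R) m (sigma : 'I_m -> R) (x' x'' : 'I_m -> X) :
    set ('I_m -> R) :=
  [set a | exists n (g : 'I_n -> X -> R), [/\ forall k, lip_dual x (g k),
     \sum_(k < n) Lip (g k) `^ v <= 1 &
     a = fun j => \sum_(k < n) `|sigma j * (g k (x' j) - g k (x'' j))| `^ v]].

Lemma test_vectors_ball x (v : R) m (sigma : 'I_m -> R) (x' x'' : 'I_m -> X) f :
  0 < v -> lip_dual_ball x f ->
  test_vectors x v sigma x' x'' (fun j => `|sigma j * (f (x' j) - f (x'' j))| `^ v).
Proof.
move=> v0 [fdual f1]; exists 1, (fun=> f); split=> //.
  rewrite big_ord1; apply: (@le_trans _ _ (1 `^ v)); last by rewrite powR1.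
  by rewrite le_powR ?Lip_ge0// ltW.
by apply/funext => j; rewrite big_ord1.
Qed.

Lemma test_vectors_bounded x (v : R) m (sigma : 'I_m -> R) (x' x'' : 'I_m -> X) a :
  0 < v -> test_vectors x v sigma x' x'' a -> forall j,
  0 <= a j <= \sum_(i < m) (`|sigma i| * mdist (x' i) (x'' i)) `^ v.
Proof.
move=> v0 [n [g [gdual gN ->]]] j; apply/andP; split.
  by apply: sumr_ge0 => k _; exact: powR_ge0.
have d0 i : 0 <= `|sigma i| * mdist (x' i) (x'' i) by rewrite mulr_ge0// mdist_ge0.
apply: (@le_trans _ _ ((`|sigma j| * mdist (x' j) (x'' j)) `^ v)); last first.
  by rewrite (bigD1 j)//= lerDl sumr_ge0// => i _; exact: powR_ge0.
apply: (@le_trans _ _ ((`|sigma j| * mdist (x' j) (x'' j)) `^ v *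
    \sum_(k < n) Lip (g k) `^ v)); last by rewrite ler_piMr// powR_ge0.
rewrite mulr_sumr; apply: ler_sum => k _.
rewrite -powRM ?Lip_ge0// le_powR ?(ltW v0)//.
by rewrite normrM -mulrA ler_wpM2l// mulrC le_Lip_mdist//; case: (gdual k).
Qed.

(** Concatenate the two families, rescaled by [(1 - lam) `^ v^-1] and
    [lam `^ v^-1]. *)
Lemma test_vectors_convex x (v : R) m (sigma : 'I_m -> R) (x' x'' : 'I_m -> X)
    (lam : R) a1 a2 : 0 < v -> 0 < lam < 1 ->
  test_vectors x v sigma x' x'' a1 -> test_vectors x v sigma x' x'' a2 ->
  test_vectors x v sigma x' x'' (fun j => (1 - lam) * a1 j + lam * a2 j).
Proof.
move=> v0 /andP[lam0 lam1] [n1 [g1 [g1d g1N ->]]] [n2 [g2 [g2d g2N ->]]].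
have vn0 : v != 0 by rewrite gt_eqF.
have lam1' : 0 < 1 - lam by rewrite subr_gt0.
pose g (k : 'I_(n1 + n2)) : X -> R := match fintype.split k with
  | inl i => fun z => (1 - lam) `^ v^-1 * g1 i z
  | inr i => fun z => lam `^ v^-1 * g2 i z end.
have gl i : g (lshift n2 i) = fun z => (1 - lam) `^ v^-1 * g1 i z.
  by rewrite /g (unsplitK (inl i)).
have gr i : g (rshift n1 i) = fun z => lam `^ v^-1 * g2 i z.
  by rewrite /g (unsplitK (inr i)).
have LipX (c : R) f : 0 < c -> lip_dual x f ->
    Lip (fun z => c `^ v^-1 * f z) `^ v <= c * Lip f `^ v.
  move=> c0 fd; rewrite -[X in X * _](powRVK vn0 (ltW c0)) -powRM ?powR_ge0 ?Lip_ge0//.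
  apply: le_powR; [exact: ltW|exact: Lip_ge0|].
  by rewrite (le_trans (LipZ_le _ fd))// ger0_norm ?powR_ge0.
exists (n1 + n2)%N, g; split.
- by move=> k; rewrite /g; case: fintype.split => i; exact: lip_dualZ.
- rewrite big_split_ord/=.
  apply: (@le_trans _ _ ((1 - lam) * (\sum_(k < n1) Lip (g1 k) `^ v) +
                         lam * (\sum_(k < n2) Lip (g2 k) `^ v))).
    rewrite !mulr_sumr lerD// ler_sum// => k _; rewrite ?gl ?gr; exact: LipX.
  by rewrite -[leRHS](subrK lam) lerD// ler_piMr// ltW.
- have termX (c : R) (f : X -> R) j : 0 < c ->
    `|sigma j * (c `^ v^-1 * f (x' j) - c `^ v^-1 * f (x'' j))| `^ v =
    c * `|sigma j * (f (x' j) - f (x'' j))| `^ v.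
    move=> c0; rewrite -mulrBr mulrCA normrM powRM// ger0_norm ?powR_ge0//.
    by rewrite powRVK// ltW.
  apply/funext => j; rewrite big_split_ord/= !mulr_sumr; congr (_ + _);
    by apply: eq_bigr => k _; rewrite ?gl ?gr termX.
Qed.

(** The coordinate [a j] is the [v]-th power of
    [|sigma j| * || (g_k (x' j) - g_k (x'' j))_k ||_v], so its power [u / v] is
    the [j]-th term of the left-hand side of the domination. *)
Lemma test_vectors_dominated x (u v : R) m (sigma : 'I_m -> R)
    (x' x'' : 'I_m -> X) (K : R) a : 0 < u -> 0 < v -> 0 <= K ->
  dominated_by x v%:E u%:E sigma x' x'' K -> test_vectors x v sigma x' x'' a ->
  \sum_(j < m) a j `^ (u / v) <= K `^ u.
Proof.
move=> u0 v0 K0 dom [n [g [gdual gN ->]]].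
have N1 : lp_norm v%:E (fun k => Lip (g k)) <= 1.
  rewrite lp_norm_fin_le// powR1.
  by under eq_bigr do rewrite ger0_norm ?Lip_ge0//.
have := le_trans (dom _ _ gdual) (ler_wpM2l K0 N1).
rewrite mulr1 lp_norm_fin_le//; apply: le_trans; rewrite le_eqVlt; apply/orP; left.
apply/eqP/eq_bigr => j _.
rewrite -(@powR_lp_norm _ v _ (fun k => sigma j * (g k (x' j) - g k (x'' j))))//.
rewrite -powRrM mulrCA mulfV ?gt_eqF// mulr1.
by rewrite lp_normZ// normrM [`|lp_norm _ _|]ger0_norm// lp_norm_ge0.
Qed.

(** The exponent [e] of [tau = b `^ e] is forced: [e * r = u / v] makes
    [\sum_j tau j `^ r] the objective at [b], and [- e * v = u / v - 1] makes
    [tau j `^ (- v)] the derivative of the objective, up to the factor [u / v]. *)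
Lemma has_weights_fin x (u v r : R) m (sigma : 'I_m -> R) (x' x'' : 'I_m -> X)
    (K K' : R) : 0 < u -> u < v -> 0 < r -> u^-1 = r^-1 + v^-1 ->
  0 <= K -> K < K' ->
  dominated_by x v%:E u%:E sigma x' x'' K ->
  has_weights x r%:E v%:E sigma x' x'' K'.
Proof.
move=> u0 uv r0 uvr K0 KK' dom; have K'0 : 0 < K' by exact: le_lt_trans KK'.
have v0 : 0 < v by exact: lt_trans uv.
have t01 : 0 < u / v < 1 by rewrite divr_gt0//= ltr_pdivrMr// mul1r.
have KuK'u : K `^ u < K' `^ u by rewrite gt0_ltr_powR// nnegrE// ltW.
have A0 : test_vectors x v sigma x' x'' !=set0.
  by eexists; apply: test_vectors_ball (lip_dual_ball_mdist x x).
have [b [b0 bM ba]] := near_maximizer_weights t01 KuK'u A0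
  (fun a Aa => test_vectors_bounded v0 Aa)
  (fun lam a1 a2 lam01 => test_vectors_convex v0 lam01)
  (fun a => test_vectors_dominated u0 v0 K0 dom).
set M := K' `^ u in KuK'u bM ba *.
have M0 : 0 <= M by exact: powR_ge0.
pose e := (1 - u / v) / v.
have er : e * r = u / v.
  have : v * r = u * v + u * r.
    have -> : v * r = u * v * r * u^-1 by field; rewrite gt_eqF.
    by rewrite uvr; field; rewrite !gt_eqF.
  rewrite /e => h; apply: (@mulfI _ (v * v)); first by rewrite mulf_neq0// gt_eqF.
  transitivity (v * r - u * r); first by field; rewrite gt_eqF.
  by rewrite h; field; rewrite gt_eqF.
exists (fun j => b j `^ e), (M `^ r^-1), (M `^ v^-1); split.
  rewrite !powR_ge0 -powRD; last by apply/implyP => _; rewrite gt_eqF// powR_gt0.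
  by rewrite -uvr powRK ?gt_eqF// ltW.
split=> [j| |f fball]; first by rewrite gt_eqF// powR_gt0.
  rewrite lp_norm_fin_le ?powR_ge0// powRVK ?gt_eqF//.
  by under eq_bigr do rewrite ger0_norm ?powR_ge0// -powRrM er.
rewrite lp_norm_fin_le ?powR_ge0// powRVK ?gt_eqF//.
apply: le_trans (ba _ (test_vectors_ball sigma x' x'' v0 fball)).
apply: ler_sum => j _; rewrite le_eqVlt; apply/orP; left; apply/eqP.
rewrite mulrAC normrM powRM// mulrC; congr (_ * _).
rewrite normfV ger0_norm ?powR_ge0// -powRN -powRrM; congr (_ `^ _).
by rewrite /e; field; rewrite gt_eqF.
Qed.

(** The converse half of the duality formula; the infimum over [tau] need not be
    attained, whence the weights for each [K + e] only. *)
Lemma mixed_lip_norm_le_of_dominated x s q m (sigma : 'I_m -> R)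
    (x' x'' : 'I_m -> X) (K : R) : (0 < q)%E -> (q <= s)%E -> 0 <= K ->
  dominated_by x s q sigma x' x'' K ->
  (mixed_lip_norm x s q sigma x' x'' <= K%:E)%E.
Proof.
move=> q0 qs K0 dom; apply/lee_addgt0Pr => e e0; rewrite -EFinD.
have KK' : K < K + e by rewrite ltrDl.
have [tau [A [B [[A0 B0 ABK] [tau0 tauA fB]]]]] :
    has_weights x (mixed_index s q) s sigma x' x'' (K + e).
  case: (mixed_index_cases q0 qs) dom => {q0 qs}[{}q q0|u u0|u v r u0 uv r0 uvr] dom.
  - apply: has_weights_diag => //; first by rewrite addr_ge0// ltW.
    move=> n g gd; apply: (le_trans (dom n g gd)).
    by rewrite ler_wpM2r ?lp_norm_ge0// ltW.
  - exact: has_weights_infty KK' dom.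
  - exact: has_weights_fin KK' dom.
apply: le_trans (mixed_lip_norm_le A0 B0 tau0 tauA fB) _.
by rewrite lee_fin.
Qed.

End weights.

(** * Equality of the constants *)

(** The weak norm [W] on the side of [X] is a common factor: apply the duality
    formula in [Y] with [K = C * W]. *)
Lemma mixed_constantsE (R : realType) (X Y : metricType R) (x0 : X) (y0 : Y)
    (p q s : \bar R) (S : X -> Y) : (0 < q)%E -> (q <= s)%E -> (0 < p)%E ->
  mixed_summing_constants x0 y0 s q p S = mixed_domination_constants x0 y0 s q p S.
Proof.
move=> q0 qs p0; apply/seteqP; split=> C [C0 hC]; split=> //.
  move=> m n sigma x' x'' g gdual.
  apply: le_trans (lp_norm_le_mixed_lip_norm sigma (S \o x') (S \o x'') q0 qs gdual) _.
  by rewrite lee_wpmul2r// lee_fin lp_norm_ge0.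
move=> m sigma x' x''.
have W0 := weak_lip_norm_ge0 x0 p sigma x' x''.
have Wfin := weak_lip_norm_fin_num x0 sigma x' x'' p0.
rewrite -(fineK Wfin) -EFinM; apply: mixed_lip_norm_le_of_dominated => //.
  by rewrite mulr_ge0// fine_ge0.
move=> n g gdual; rewrite -lee_fin !EFinM (fineK Wfin).
exact: hC.
Qed.

Theorem theorem4p1 (R : realType) (X Y : metricType R) (x0 : X) (y0 : Y)
    (p q s : \bar R) (S : X -> Y) :
  (0 < q)%E -> (q <= s)%E -> (0 < p)%E -> (p <= q)%E -> lipschitz_map S ->
  (mixed_summing x0 y0 s q p S <->
     exists C : R, mixed_domination_constants x0 y0 s q p S C) /\
  mixed_summing_norm x0 y0 s q p S =
    ereal_inf [set C%:E | C in mixed_domination_constants x0 y0 s q p S].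
Proof.
move=> q0 qs p0 _ _.
by rewrite /mixed_summing /mixed_summing_norm mixed_constantsE.
Qed.
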